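(* Let $m$, $n$ and $q$ be positive integers such that $mnq$ is even. Then \[ \sum_{k = 1}^\infty \frac{L_{nk+mnq}}{\prod_{j=0}^{2m} F_{nk+njq}} = \frac{1}{F_{mnq}}\sum_{k=1}^{q}\frac{1}{\prod_{j=0}^{2m-1}F_{nk+njq}}. \]
   Context: The Fibonacci numbers are defined by $F_0=0$, $F_1=1$, $F_n=F_{n-1}+F_{n-2}$, and the Lucas numbers by $L_0=2$, $L_1=1$, $L_n=L_{n-1}+L_{n-2}$. Infinite sums are limits of partial sums. *)

(* Defs.v *)
From mathcomp Require Import all_boot.

Fixpoint fib (n : nat) : nat :=
  match n with
  | 0 => 0
  | n'.+1 => if n' is n''.+1 then fib n' + fib n'' else 1
  end.

Fixpoint lucas (n : nat) : nat :=
  match n with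
  | 0 => 2
  | n'.+1 => if n' is n''.+1 then lucas n' + lucas n'' else 1
  end.

(* Main.v *)
(** Since [b = mnq] is even, [F_(a+2b) - F_a = L_(a+b) F_b].  With [a = nk] this
    turns the summand into [(G k - G (k+q)) / F_b], where [G k] is the inverse
    of the product of the [F_(nk+njq)] over [j < 2m]; the sum telescopes with
    step [q], and the [q] boundary terms [G (N+k)] tend to [0]. *)
Require Import Defs.
From mathcomp Require Import all_boot all_order all_algebra.
From mathcomp Require Import all_classical all_reals all_analysis.
From mathcomp Require Import zify ring.
Import Order.TTheory GRing.Theory Num.Theory numFieldNormedType.Exports.
Local Open Scope classical_set_scope.
Local Open Scope ring_scope.

Lemma fibSS n : fib n.+2 = (fib n.+1 + fib n)%N.
Proof. by []. Qed.

Lemma lucasSS n : lucas n.+2 = (lucas n.+1 + lucas n)%N.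
Proof. by []. Qed.

Lemma nat_ind2 (P : nat -> Prop) :
  P 0%N -> P 1%N -> (forall n, P n -> P n.+1 -> P n.+2) -> forall n, P n.
Proof.
move=> P0 P1 PSS n; suff: P n /\ P n.+1 by case.
by elim: n => [|n [Pn PSn]]; split=> //; apply: PSS.
Qed.

Lemma fib_addS x y :
  fib (x + y).+1 = (fib x.+1 * fib y.+1 + fib x * fib y)%N.
Proof.
elim: x y => [|x IHx] y; first by rewrite add0n /=; lia.
by rewrite addSnnS IHx (fibSS x) (fibSS y); lia.
Qed.

Lemma lucas_fib n : lucas n.+1 = (fib n.+2 + fib n)%N.
Proof.
elim/nat_ind2: n => // n IH0 IH1.
by rewrite lucasSS IH0 IH1 !fibSS; lia.
Qed.

Lemma fib_double b : fib (b + b) = (lucas b * fib b)%N.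
Proof.
case: b => // b.
by rewrite addnS fib_addS lucas_fib !fibSS; lia.
Qed.

(** Cassini's identity at an even index, free of subtraction: the form $y^2 - xy - x^2$ is invariant
    under the double step $(x, y) \mapsto (x + y, x + 2y)$. *)
Lemma fib_cassini_even c :
  (fib c.*2.+1 * fib c.*2.+1 =
   1 + fib c.*2 * fib c.*2 + fib c.*2 * fib c.*2.+1)%N.
Proof.
elim: c => // c; rewrite doubleS !fibSS.
by move: (fib _) (fib _) => x y; lia.
Qed.

(** Both sides obey the Fibonacci recurrence in [a], so [a = 0] and [a = 1] suffice. The first is
    the doubling formula; the second reduces to Cassini, where the parity of [b] fixes the sign. *)
Lemma fib_sub_lucas a b : ~~ odd b ->
  fib (a + b + b) = (fib a + lucas (a + b) * fib b)%N.
Proof.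
move=> b_even; elim/nat_ind2: a => [||a IH0 IH1].
- by rewrite !add0n fib_double.
- rewrite !add1n addSn fib_addS lucas_fib fibSS.
  have := fib_cassini_even b./2; rewrite even_halfK //; lia.
- by rewrite !addSn !fibSS lucasSS -!addSn IH0 IH1; lia.
Qed.

Lemma leq_fibS n : (n <= fib n.+1)%N.
Proof.
elim/nat_ind2: n => // -[|n] IH0 IH1 //; rewrite fibSS; lia.
Qed.

Lemma fib_gt0 n : (0 < n)%N -> (0 < fib n)%N.
Proof. by case: n => // -[//|n] _; have := leq_fibS n.+1; lia. Qed.

Lemma sum_telescope_step (V : zmodType) (G : nat -> V) (q N : nat) :
  \sum_(1 <= k < N.+1) (G k - G (k + q)%N) =
  \sum_(1 <= k < q.+1) G k - \sum_(1 <= k < q.+1) G (N + k)%N.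
Proof.
elim: N => [|N IHN]; first by rewrite big_geq // subrr.
have -> : \sum_(1 <= k < q.+1) G (N.+1 + k)%N =
          \sum_(1 <= k < q.+1) G (N + k)%N + G (N.+1 + q)%N - G N.+1.
  (* Extend the old window on the right to [q.+1] terms, then cancel its first term. *)
  rewrite addSnnS -(big_nat_recr q.+1 1 (fun k => G (N + k)%N)) // big_ltn //.
  rewrite addn1 addrC addKr [RHS]big_add1 /=.
  by apply: eq_bigr => k _; rewrite addSnnS.
by rewrite big_nat_recr //= IHN opprB opprD -addrA [in RHS](addrCA (G _)).
Qed.

(** The factor [j = 0] grows at least linearly by [leq_fibS] and the other factors are at least 1,
    so the inverse is squeezed between 0 and the harmonic sequence. *)
Lemma cvg_inv_fib_prod (R : realType) (n q l k : nat) :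
  (0 < n)%N -> (0 < l)%N ->
  (fun N => (\prod_(0 <= j < l) (fib (n * (N + k) + n * j * q))%:R)^-1 : R)
    @ \oo --> (0 : R).
Proof.
(* The shift by 2 makes every index positive and gives $n(N+2+k) - 1 \ge N + 1$, the denominator of
   [harmonic N]. *)
move=> n_gt0 l_gt0; rewrite -(cvg_shiftn 2) /=.
apply: (@squeeze_cvgr _ _ _ _ (fun=> 0) (@harmonic R)); last 2 first.
- exact: cvg_cst.
- exact: cvg_harmonic.
near=> N; rewrite -natr_prod invr_ge0 ler0n /=.
rewrite /harmonic /= lef_pV2 ?posrE ?ltr0n ?prodn_gt0 //; last first.
  by move=> j; apply: fib_gt0; nia.
rewrite ler_nat big_ltn // muln0 mul0n addn0.
rewrite (@leq_trans (fib (n * (N + 2 + k)))) ?leq_pmulr ?prodn_gt0 //.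
  have <- : (n * (N + 2 + k)).-1.+1 = (n * (N + 2 + k))%N by nia.
  by apply: leq_trans (leq_fibS _); nia.
by move=> j; apply: fib_gt0; nia.
Unshelve. all: end_near. Qed.

Theorem theorem2p20 (R : realType) (m n q : nat)
    (m_gt0 : (0 < m)%N) (n_gt0 : (0 < n)%N) (q_gt0 : (0 < q)%N)
    (mnq_even : ~~ odd (m * n * q)) :
  (fun N : nat => \sum_(1 <= k < N.+1)
      (lucas (n * k + m * n * q))%:R /
      \prod_(0 <= j < (2 * m).+1) (fib (n * k + n * j * q))%:R : R) @ \oo -->
  ((fib (m * n * q))%:R^-1 *
    \sum_(1 <= k < q.+1)
      (\prod_(0 <= j < 2 * m) (fib (n * k + n * j * q))%:R)^-1 : R).
Proof.
set b := (m * n * q)%N.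
pose P k : R := \prod_(0 <= j < 2 * m) (fib (n * k + n * j * q))%:R.
have fib_neq0 x : (0 < x)%N -> (fib x)%:R != 0 :> R.
  by move=> x_gt0; rewrite pnatr_eq0 -lt0n fib_gt0.
have P_neq0 k : (0 < k)%N -> P k != 0.
  by move=> k_gt0; rewrite prodf_seq_neq0; apply/allP => j _; apply: fib_neq0; nia.
have Fb_neq0 : (fib b)%:R != 0 :> R by apply: fib_neq0; rewrite /b; nia.
have termE k : (0 < k)%N ->
    (lucas (n * k + b))%:R /
      \prod_(0 <= j < (2 * m).+1) (fib (n * k + n * j * q))%:R =
    (fib b)%:R^-1 * ((P k)^-1 - (P (k + q)%N)^-1) :> R.
  move=> k_gt0.
  (* Split off the last factor, [j = 2 * m], whose index is $nk + 2b$. *)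
  have prodr : \prod_(0 <= j < (2 * m).+1) (fib (n * k + n * j * q))%:R =
      P k * (fib (n * k + b + b))%:R :> R.
    by rewrite big_nat_recr //=; congr (_ * (fib _)%:R); rewrite /b; lia.
  (* Split off the first factor instead: in the rest, $nk + n(j+1)q = n(k+q) + njq$. *)
  have prodl : P k * (fib (n * k + b + b))%:R =
      (fib (n * k))%:R * P (k + q)%N :> R.
    rewrite -prodr big_nat_recl //= muln0 mul0n addn0; congr (_ * _).
    by apply: eq_bigr => j _; congr (fib _)%:R; lia.
  rewrite prodr.
  have F2_neq0 : (fib (n * k + b + b))%:R != 0 :> R by apply: fib_neq0; nia.
  have Pk0 := P_neq0 k k_gt0.
  have Pkq0 : P (k + q)%N != 0 by apply: P_neq0; lia.
  have lucasE : (lucas (n * k + b))%:R * (fib b)%:R =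
      (fib (n * k + b + b))%:R - (fib (n * k))%:R :> R.
    by rewrite fib_sub_lucas // natrD natrM addrC addKr.
  (* Put both inverses over the full product; the numerators then differ by [lucasE]. *)
  have -> : (P (k + q)%N)^-1 =
      (fib (n * k))%:R / (P k * (fib (n * k + b + b))%:R).
    rewrite prodl invfM mulrA mulfV ?mul1r //; apply: fib_neq0; nia.
  apply: (mulfI Fb_neq0); rewrite mulVKf // mulrA [(fib b)%:R * _]mulrC lucasE.
  by field; apply/andP.
have -> : (fun N : nat => \sum_(1 <= k < N.+1) (lucas (n * k + b))%:R /
      \prod_(0 <= j < (2 * m).+1) (fib (n * k + n * j * q))%:R : R) =
    (fun N => (fib b)%:R^-1 * (\sum_(1 <= k < q.+1) (P k)^-1 -
       \sum_(1 <= k < q.+1) (P (N + k)%N)^-1)).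
  apply/funext => N; rewrite -(@sum_telescope_step _ (fun k => (P k)^-1)).
  by rewrite big_distrr /=; apply: eq_big_nat => k /andP[k_gt0 _]; apply: termE.
apply: cvgMr; rewrite -[X in _ --> X]subr0.
apply: cvgB; first exact: cvg_cst.
(* Writing the limit 0 as a sum of [q] zeros lets the boundary sum converge term by term. *)
rewrite [X in _ --> X](_ : 0 = \sum_(1 <= k < q.+1) (0 : R)); last first.
  by rewrite big1.
apply: cvg_big => [|k _]; first exact: add_continuous.
by apply: cvg_inv_fib_prod => //; lia.
Qed.
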